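(* The $\mathbb{Q}$-vector space $\mathcal{MD}$ is closed under the ordinary multiplication of formal power series in $\mathbb{Q}[[q]]$, so $(\mathcal{MD},\cdot)$ is a $\mathbb{Q}$-algebra; moreover it is bifiltered by weight and length in the sense that for all $k_1,k_2,l_1,l_2\ge 0$ \[ \mathrm{Fil}^{W,L}_{k_1,l_1}(\mathcal{MD})\cdot \mathrm{Fil}^{W,L}_{k_2,l_2}(\mathcal{MD})\subset \mathrm{Fil}^{W,L}_{k_1+k_2,\,l_1+l_2}(\mathcal{MD}). \]
   Context: For integers $r_1,\dots,r_l\ge 0$ and $n\ge 1$ define the multiple divisor sum $\sigma_{r_1,\dots,r_l}(n)=\sum v_1^{r_1}\cdots v_l^{r_l}$, where the sum runs over all positive integers $u_1>u_2>\dots>u_l>0$ and $v_1,\dots,v_l>0$ with $u_1v_1+\dots+u_lv_l=n$. For integers $s_1,\dots,s_l\ge 1$ the bracket is the formal power series $[s_1,\dots,s_l]=\frac{1}{(s_1-1)!\cdots(s_l-1)!}\sum_{n>0}\sigma_{s_1-1,\dots,s_l-1}(n)q^n\in\mathbb{Q}[[q]]$; its weight is $s_1+\dots+s_l$ and its length is $l$. The empty bracket $[\emptyset]=1$ has weight and length $0$. $\mathcal{MD}$ is the $\mathbb{Q}$-vector space spanned by $1$ and all brackets. $\mathrm{Fil}^{W,L}_{k,l}(\mathcal{MD})$ denotes the $\mathbb{Q}$-span of all brackets (including $1$) of weight $\le k$ and length $\le l$. *)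

(* Defs.v *)
From HB Require Import structures.
From mathcomp Require Import all_boot all_order all_algebra.
From mathcomp Require Import boolp classical_sets.

Set Implicit Arguments.
Unset Strict Implicit.
Unset Printing Implicit Defensive.

Import GRing.Theory.
Local Open Scope ring_scope.

(** * Formal power series over a commutative ring, as a commutative algebra *)

(* [f] stands for [\sum_n fps_coef f n q^n]. *)
Record fps (R : Type) := Fps { fps_coef : nat -> R }.

HB.instance Definition _ (R : Type) := gen_eqMixin (fps R).
HB.instance Definition _ (R : Type) := gen_choiceMixin (fps R).

Lemma fpsP (R : Type) (f g : fps R) :
  (forall n, fps_coef f n = fps_coef g n) -> f = g.
Proof. by case: f g => [f] [g] /= fg; congr Fps; apply/funext. Qed.

Section FpsAlgebra.
Variable R : comNzRingType.
Implicit Types f g h : fps R.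

Definition fps_zero : fps R := Fps (fun=> 0).
Definition fps_opp f : fps R := Fps (fun n => - fps_coef f n).
Definition fps_add f g : fps R := Fps (fun n => fps_coef f n + fps_coef g n).
Definition fps_one : fps R := Fps (fun n => (n == 0)%:R).
Definition fps_mul f g : fps R :=
  Fps (fun n => \sum_(i < n.+1) fps_coef f i * fps_coef g (n - i)).
Definition fps_scale (a : R) f : fps R := Fps (fun n => a * fps_coef f n).

Fact fps_addA : associative fps_add.
Proof. by move=> f g h; apply: fpsP => n /=; rewrite addrA. Qed.
Fact fps_addC : commutative fps_add.
Proof. by move=> f g; apply: fpsP => n /=; rewrite addrC. Qed.
Fact fps_add0 : left_id fps_zero fps_add.
Proof. by move=> f; apply: fpsP => n /=; rewrite add0r. Qed.
Fact fps_addN : left_inverse fps_zero fps_opp fps_add.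
Proof. by move=> f; apply: fpsP => n /=; rewrite addNr. Qed.

HB.instance Definition _ :=
  GRing.isZmodule.Build (fps R) fps_addA fps_addC fps_add0 fps_addN.

(* Truncation to a polynomial, used to inherit the ring laws from {poly R}. *)
Let tr n f : {poly R} := \poly_(i < n.+1) fps_coef f i.

Let tr_coef n f i : (i <= n)%N -> (tr n f)`_i = fps_coef f i.
Proof. by move=> le_in; rewrite coef_poly ltnS le_in. Qed.

Let tr_mul n f g i : (i <= n)%N -> fps_coef (fps_mul f g) i = (tr n f * tr n g)`_i.
Proof.
move=> le_in; rewrite coefM; apply: eq_bigr => j _.
by rewrite !tr_coef // ?(leq_trans (leq_subr _ _)) // (leq_trans _ le_in) // -ltnS.
Qed.

Fact fps_mulA : associative fps_mul.
Proof.
move=> f g h; apply: fpsP => n.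
transitivity ((tr n f * (tr n g * tr n h))`_n).
  rewrite coefM; apply: eq_bigr => i _.
  by rewrite tr_coef ?(tr_mul (n := n)) ?leq_subr // -ltnS.
rewrite mulrA coefM; apply: eq_bigr => i _.
by rewrite tr_coef ?leq_subr // (tr_mul (n := n)) // -ltnS.
Qed.

Fact fps_mulC : commutative fps_mul.
Proof.
by move=> f g; apply: fpsP => n; rewrite !(tr_mul (n := n)) ?leqnn // mulrC.
Qed.

Fact fps_mul1 : left_id fps_one fps_mul.
Proof.
move=> f; apply: fpsP => n /=; rewrite big_ord_recl /= mul1r subn0.
by rewrite big1 ?addr0 // => i _; rewrite mul0r.
Qed.

Fact fps_mulDl : left_distributive fps_mul fps_add.
Proof.
move=> f g h; apply: fpsP => n /=; rewrite -big_split.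
by apply: eq_bigr => i _; rewrite mulrDl.
Qed.

Fact fps_oner_neq0 : fps_one != fps_zero.
Proof.
apply/eqP => /(congr1 (fun f => fps_coef f 0)) /= /eqP.
by rewrite oner_eq0.
Qed.

HB.instance Definition _ := GRing.Zmodule_isComNzRing.Build (fps R)
  fps_mulA fps_mulC fps_mul1 fps_mulDl fps_oner_neq0.

Fact fps_scaleA a b f : fps_scale a (fps_scale b f) = fps_scale (a * b) f.
Proof. by apply: fpsP => n /=; rewrite mulrA. Qed.
Fact fps_scale1 : left_id 1 fps_scale.
Proof. by move=> f; apply: fpsP => n /=; rewrite mul1r. Qed.
Fact fps_scaleDr : right_distributive fps_scale +%R.
Proof. by move=> a f g; apply: fpsP => n /=; rewrite mulrDr. Qed.
Fact fps_scaleDl f : {morph fps_scale^~ f : a b / a + b}.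
Proof. by move=> a b; apply: fpsP => n /=; rewrite mulrDl. Qed.

HB.instance Definition _ := GRing.Zmodule_isLmodule.Build R (fps R)
  fps_scaleA fps_scale1 fps_scaleDr fps_scaleDl.

Fact fps_scaleAl (a : R) f g : a *: (f * g) = (a *: f) * g.
Proof.
apply: fpsP => n /=; rewrite big_distrr; apply: eq_bigr => i _ /=.
by rewrite mulrA.
Qed.

HB.instance Definition _ := GRing.Lmodule_isLalgebra.Build R (fps R) fps_scaleAl.
HB.instance Definition _ := GRing.Lalgebra_isComAlgebra.Build R (fps R).

End FpsAlgebra.

(** * Linear span of an arbitrary subset of a module *)

Definition lspan (K : nzRingType) (V : lmodType K) (A : set V) : set V :=
  [set x | exists (n : nat) (c : 'I_n -> K) (v : 'I_n -> V),
     (forall i, A (v i)) /\ x = \sum_(i < n) c i *: v i]%classic.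

(** * Multiple divisor sums and brackets *)

(* For [n >= 1], all [u_i, v_i >= 1] with [\sum_i u_i v_i = n] are at most [n],
   so letting them range over ['I_n.+1] loses nothing. *)
Definition mdsum (r : seq nat) (n : nat) : nat :=
  let l := size r in
  (\sum_(u : {ffun 'I_l -> 'I_n.+1})
   \sum_(v : {ffun 'I_l -> 'I_n.+1} |
         [&& [forall i, 0 < u i], [forall i, 0 < v i],
             [forall i : 'I_l, forall j : 'I_l, (i < j) ==> (u j < u i)]
           & \sum_(i < l) u i * v i == n])
   \prod_(i < l) v i ^ nth 0 r i)%N.

Definition bracket (s : seq nat) : fps rat :=
  if s is [::] then 1 else
  (\prod_(x <- s) (x.-1)`!%:R)^-1 *:
    Fps (fun n => if n == 0 then 0 else (mdsum [seq x.-1 | x <- s] n)%:R).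

Definition weight (s : seq nat) : nat := sumn s.

(* A bracket index: a possibly empty sequence of positive integers. *)
Definition index_seq (s : seq nat) : bool := all (fun x => 0 < x)%N s.

Definition MD : set (fps rat) :=
  lspan [set bracket s | s in [set s | index_seq s]]%classic.

Definition FilWL (k l : nat) : set (fps rat) :=
  lspan [set bracket s | s in
    [set s | [/\ index_seq s, (weight s <= k)%N & (size s <= l)%N]]]%classic.

(* Main.v *)
(** Write [Li_s(z) = \sum_(v > 0) v^(s-1) z^v / (s-1)!]. Then [s_1, ..., s_l] is
    the sum over [u_1 > ... > u_l > 0] of [\prod_i Li_{s_i}(q^{u_i})], and such
    iterated sums multiply by a quasi-shuffle as soon as [Li_a * Li_b] is a linear
    combination of [Li_1, ..., Li_{a+b}]. The latter holds because
    [\sum_(0 < v < n) v^(a-1) (n-v)^(b-1)] is a polynomial in [n], for [n > 0],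
    of degree less than [a + b]. The quasi-shuffle is carried out on the sums
    truncated to [u_1 <= N], as functions of [N]; the coefficient of [q^n] is
    stationary for [N >= n]. *)

Require Import Defs.
From mathcomp Require Import all_boot all_order all_algebra.
From mathcomp Require Import boolp classical_sets functions.
From mathcomp Require Import ring zify.

Set Implicit Arguments.
Unset Strict Implicit.
Unset Printing Implicit Defensive.

Import GRing.Theory Num.Theory.
Local Open Scope ring_scope.
Local Open Scope classical_set_scope.

(** * Power sums and their convolutions as polynomial functions *)

Section PolynomialFunctions.

(* The value at [0] is unconstrained: the power sums below break the pattern
   there. *)
Definition polyfun (d : nat) (f : nat -> rat) : Prop :=
  exists2 p : {poly rat}, (size p <= d)%N &
    forall m : nat, (0 < m)%N -> f m = p.[m%:R].

Lemma polyfun_eq d f g :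
  (forall m, (0 < m)%N -> f m = g m) -> polyfun d f -> polyfun d g.
Proof. by move=> fg [p sp fp]; exists p => // m m0; rewrite -fg ?fp. Qed.

Lemma polyfun_le d e f : (d <= e)%N -> polyfun d f -> polyfun e f.
Proof. by move=> de [p sp fp]; exists p => //; exact: leq_trans de. Qed.

Lemma polyfunD d f g :
  polyfun d f -> polyfun d g -> polyfun d (fun m => f m + g m).
Proof.
move=> [p sp fp] [q sq gq]; exists (p + q).
  by rewrite (leq_trans (size_polyD _ _)) // geq_max sp.
by move=> m m0; rewrite hornerD fp ?gq.
Qed.

Lemma polyfunZ d c f : polyfun d f -> polyfun d (fun m => c * f m).
Proof.
move=> [p sp fp]; exists (c *: p); first exact: leq_trans (size_scale_leq _ _) sp.
by move=> m m0; rewrite hornerZ fp.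
Qed.

Lemma polyfun_sum d n (F : 'I_n -> nat -> rat) :
  (forall i, polyfun d (F i)) -> polyfun d (fun m => \sum_(i < n) F i m).
Proof.
elim: n F => [|n IH] F FP.
  by exists 0; rewrite ?size_poly0 // => m _; rewrite big_ord0 horner0.
apply: polyfun_eq (polyfunD (IH _ (fun i => FP (widen_ord (leqnSn n) i))) (FP ord_max)).
by move=> m _; rewrite big_ord_recr.
Qed.

Lemma polyfun_exp r : polyfun r.+1 (fun m => m%:R ^+ r).
Proof. by exists 'X^r; rewrite ?size_polyXn // => m _; rewrite hornerXn. Qed.

Lemma polyfun_mulX d f : polyfun d f -> polyfun d.+1 (fun m => m%:R * f m).
Proof.
move=> [p sp fp]; exists ('X * p); last by move=> m m0; rewrite hornerM hornerX fp.
have [->|p0] := eqVneq p 0; first by rewrite mulr0 size_poly0.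
by rewrite mulrC size_mulX.
Qed.

(** Strong induction on [r]: the differences of [i ^ (r+1)] telescope, and their binomial expansion
    is [r+1] times [i ^ r] plus lower powers. *)
Lemma polyfun_power_sum r : polyfun r.+2 (fun m => \sum_(1 <= i < m) i%:R ^+ r).
Proof.
elim/ltn_ind: r => r IH.
pose low m : rat := \sum_(j < r) 'C(r.+1, j)%:R * \sum_(1 <= i < m) i%:R ^+ j.
have lowP : polyfun r.+2 low.
  apply: polyfun_sum => j; apply: polyfunZ; apply: polyfun_le (IH j (ltn_ord j)).
  by rewrite !ltnS ltnW.
have oneP : polyfun r.+2 (fun m => m%:R ^+ 0) by exact: polyfun_le (polyfun_exp 0).
(* The telescoped identity solved for the power sum: [(m ^ (r+1) - (low m + 1)) / (r+1)]. *)
have := polyfunZ r.+1%:R^-1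
  (polyfunD (polyfun_exp r.+1) (polyfunZ (- 1) (polyfunD lowP oneP))).
apply: polyfun_eq => m m0.
have nz : r.+1%:R != 0 :> rat by rewrite pnatr_eq0.
apply: (mulfI nz); rewrite mulVKf //.
have : \sum_(1 <= i < m) (i.+1%:R ^+ r.+1 - i%:R ^+ r.+1) = m%:R ^+ r.+1 - 1 :> rat.
  by rewrite (telescope_sumr (fun i => i%:R ^+ r.+1)) // expr1n.
have binE (i : nat) : i.+1%:R ^+ r.+1 - i%:R ^+ r.+1 =
    \sum_(j < r) 'C(r.+1, j)%:R * i%:R ^+ j + r.+1%:R * i%:R ^+ r :> rat.
  rewrite -addn1 natrD (addrC i%:R) exprDn.
  under eq_bigr do rewrite expr1n mul1r -mulr_natl.
  by rewrite !big_ord_recr /= binn mul1r binSn addrK.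
under eq_bigr do rewrite binE.
rewrite big_split exchange_big /= -mulr_sumr.
rewrite (_ : \sum_(j < r) _ = low m); last first.
  by apply: eq_bigr => j _; rewrite mulr_sumr.
by rewrite expr0; move=> E; apply: (addrI (low m)); rewrite E; ring.
Qed.

(** Induction on [t] through [(m - i) ^ (t+1) = m (m - i) ^ t - i (m - i) ^ t]: the factor [m]
    raises the degree by one, while the factor [i] turns [r] into [r+1]. *)
Lemma polyfun_convolution r t :
  polyfun (r + t).+2 (fun m => \sum_(1 <= i < m) i%:R ^+ r * (m - i)%:R ^+ t).
Proof.
elim: t r => [|t IH] r.
  rewrite addn0; apply: polyfun_eq (polyfun_power_sum r) => m _.
  by apply: eq_bigr => i _; rewrite expr0 mulr1.
have h := IH r.+1; rewrite addSn -addnS in h.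
have k := polyfun_mulX (IH r); rewrite -addnS in k.
apply: polyfun_eq (polyfunD k (polyfunZ (- 1) h)) => m _.
rewrite !mulr_sumr -big_split; apply: eq_big_nat => i /andP[_ im] /=.
by rewrite natrB 1?ltnW // !exprS; ring.
Qed.

End PolynomialFunctions.

(** * The substitution of [q ^ u] for [q] *)

Section Substitution.
Variable R : comNzRingType.
Implicit Types f g : fps R.

(* [f(q)] is mapped to [f(q^u)]. *)
Definition fps_dil (u : nat) f : fps R :=
  Fps (fun n => if (u %| n)%N then fps_coef f (n %/ u) else 0).

Lemma fps_coefM f g n :
  fps_coef (f * g) n = \sum_(i < n.+1) fps_coef f i * fps_coef g (n - i).
Proof. by []. Qed.

Lemma fps_coefD f g n : fps_coef (f + g) n = fps_coef f n + fps_coef g n.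
Proof. by []. Qed.

Lemma fps_coefZ c f n : fps_coef (c *: f) n = c * fps_coef f n.
Proof. by []. Qed.

Lemma fps_coef_sum (I : Type) (s : seq I) (P : pred I) (F : I -> fps R) n :
  fps_coef (\sum_(i <- s | P i) F i) n = \sum_(i <- s | P i) fps_coef (F i) n.
Proof. by elim/big_rec2: _ => // i x y _ <-. Qed.

(** Reindexing by [i = u v]. The free bound [M] later gives all indices of a divisor sum one common
    range. *)
Lemma sum_multiples (u n M : nat) (F : nat -> R) : (0 < u)%N -> (n <= M)%N ->
  \sum_(i < n.+1 | (u %| i)%N) F i = \sum_(v < M.+1 | (u * v <= n)%N) F (u * v)%N.
Proof.
move=> u0 nM.
have leM (i : 'I_n.+1) : (i %/ u < M.+1)%N.
  by rewrite ltnS (leq_trans (leq_div _ _)) // (leq_trans _ nM) // -ltnS.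
rewrite (reindex_onto (fun v : 'I_M.+1 => inord (u * v) : 'I_n.+1)
   (fun i : 'I_n.+1 => inord (i %/ u) : 'I_M.+1)) /=; last first.
  by move=> i d; apply/val_inj; rewrite /= (inordK (leM i)) mulnC divnK // inordK.
have cond (v : 'I_M.+1) :
    (u %| (inord (u * v) : 'I_n.+1))%N &&
    (inord ((inord (u * v) : 'I_n.+1) %/ u) == v) = (u * v <= n)%N.
  have [le|gt] := leqP (u * v) n.
    by rewrite inordK ?ltnS // dvdn_mulr // mulKn // inord_val eqxx.
  (* Here [inord] returns a default; a multiple of [u] with quotient [v] would equal [u * v], which
     exceeds [n]. *)
  apply/negbTE/negP => /andP[d /eqP/(congr1 val)]; rewrite /= inordK // => e.
  by move: gt; rewrite -e mulnC divnK // ltnNge -ltnS ltn_ord.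
by apply: eq_big => // v; rewrite cond => le; rewrite inordK.
Qed.

Lemma fps_coef_dilM (u n M : nat) f g : (0 < u)%N -> (n <= M)%N ->
  fps_coef (fps_dil u f * g) n =
  \sum_(v < M.+1 | (u * v <= n)%N) fps_coef f v * fps_coef g (n - u * v).
Proof.
move=> u0 nM; rewrite fps_coefM.
rewrite (eq_bigr (fun i : 'I_n.+1 => if (u %| i)%N
    then fps_coef f (i %/ u) * fps_coef g (n - i) else 0)); last first.
  by move=> i _ /=; case: ifP; rewrite ?mul0r.
rewrite -big_mkcond.
rewrite (@sum_multiples u n M (fun i => fps_coef f (i %/ u) * fps_coef g (n - i))) //.
by apply: eq_bigr => v _; rewrite mulKn.
Qed.

Lemma fps_dilM u f g : (0 < u)%N -> fps_dil u (f * g) = fps_dil u f * fps_dil u g.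
Proof.
move=> u0; apply: fpsP => n; rewrite (@fps_coef_dilM u n n) //=.
case: ifPn => [/dvdnP[m ->{n}]|ndvd].
  rewrite mulnK // mulnC (big_ord_widen (u * m).+1
    (fun i => fps_coef f i * fps_coef g (m - i))) ?ltnS ?leq_pmull //.
  apply: eq_big => [v|v]; first by rewrite leq_pmul2l.
  by rewrite -mulnBr dvdn_mulr // mulKn.
rewrite big1 // => v le; case: ifP => [d|_]; rewrite ?mulr0 //.
by case/negP: ndvd; rewrite -(subnK le) dvdn_add ?dvdn_mulr.
Qed.

Lemma fps_dil_sum u n (c : 'I_n -> R) (f : 'I_n -> fps R) :
  fps_dil u (\sum_i c i *: f i) = \sum_i c i *: fps_dil u (f i).
Proof.
apply: fpsP => m; rewrite [RHS]fps_coef_sum /= fps_coef_sum.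
case: (u %| m)%N; first by [].
by rewrite big1 // => i _; rewrite mulr0.
Qed.

End Substitution.

(** * Linear spans and products of spans *)

Section Span.
Variables (K : nzRingType) (V : lmodType K).
Implicit Types A B : set V.

Lemma lspan_sub A : A `<=` lspan A.
Proof.
move=> x Ax; exists 1, (fun=> 1), (fun=> x); split=> //.
by rewrite big_ord1 scale1r.
Qed.

Lemma lspan0 A : lspan A 0.
Proof. by exists 0, (fun=> 0), (fun=> 0); split; [case | rewrite big_ord0]. Qed.

Lemma lspan_linear A a x y : lspan A x -> lspan A y -> lspan A (a *: x + y).
Proof.
move=> [m [c [v [Av ->]]]] [n [d [w [Aw ->]]]].
exists (m + n)%N,
  (fun i => match fintype.split i with inl j => a * c j | inr j => d j end),
  (fun i => match fintype.split i with inl j => v j | inr j => w j end).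
split=> [i|]; first by case: (fintype.split i).
rewrite big_split_ord scaler_sumr /=; congr (_ + _); apply: eq_bigr => i _.
  by rewrite (unsplitK (inl _ i)) scalerA.
by rewrite (unsplitK (inr _ i)).
Qed.

Lemma lspan_ind A (P : set V) :
  P 0 -> (forall a x y, P x -> P y -> P (a *: x + y)) -> A `<=` P -> lspan A `<=` P.
Proof.
move=> P0 PL AP _ [n [c [v [Av ->]]]].
by elim/big_rec: _ => // i x _ Px; apply: PL => //; apply: AP.
Qed.

Lemma lspanD A x y : lspan A x -> lspan A y -> lspan A (x + y).
Proof. by move=> Ax Ay; rewrite -[x]scale1r; exact: lspan_linear. Qed.

Lemma lspanZ A a x : lspan A x -> lspan A (a *: x).
Proof. by move=> Ax; rewrite -[_ *: _]addr0; apply: lspan_linear (lspan0 A). Qed.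

Lemma lspan_sum A n (F : 'I_n -> V) :
  (forall i, lspan A (F i)) -> lspan A (\sum_i F i).
Proof.
move=> AF; elim/big_rec: _ => [|i x _]; [exact: lspan0 | exact: lspanD].
Qed.

Lemma lspanS A B : A `<=` B -> lspan A `<=` lspan B.
Proof.
move=> AB; apply: lspan_ind => [|a x y|x Ax]; first exact: lspan0.
  exact: lspan_linear.
by apply: lspan_sub; apply: AB.
Qed.

End Span.

Lemma lspanM (K : comNzRingType) (V : algType K) (A B C : set V) :
  (forall x y, A x -> B y -> lspan C (x * y)) ->
  forall x y, lspan A x -> lspan B y -> lspan C (x * y).
Proof.
move=> ABC x y Ax By; move: y By.
apply: lspan_ind => [|a y z Cy Cz|y By].
- by rewrite mulr0; exact: lspan0.
- by rewrite mulrDr -scalerAr; exact: lspan_linear.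
move: x Ax; apply: lspan_ind => [|a x z Cx Cz|x Ax]; last exact: ABC.
- by rewrite mul0r; exact: lspan0.
- by rewrite mulrDl -scalerAl; exact: lspan_linear.
Qed.

(* [Li r] is [Li_{r + 1}], indexed by the exponent. *)
Definition Li (r : nat) : fps rat :=
  Fps (fun v => if v == 0%N then 0 else v%:R ^+ r / r`!%:R).

(** Up to factorials, the coefficients of the product are the convolution of powers, a polynomial in
    [n > 0]. *)
Lemma Li_mul r t : exists c : 'I_(r + t).+2 -> rat,
  Li r * Li t = \sum_j c j *: Li j.
Proof.
have [p sp pP] := polyfun_convolution r t.
(* The factor [j!] cancels the denominator in [Li j]. *)
exists (fun j => p`_j * j`!%:R / (r`!%:R * t`!%:R)).
apply: fpsP => n; rewrite fps_coefM fps_coef_sum.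
(* At [n = 0] both sides vanish, so the value of [p] there is irrelevant. *)
case: n => [|n].
  by rewrite big_ord1 mul0r big1 // => j _; rewrite fps_coefZ mulr0.
transitivity (p.[n.+1%:R] / (r`!%:R * t`!%:R)).
  rewrite -pP // -(big_mkord xpredT
    (fun i => fps_coef (Li r) i * fps_coef (Li t) (n.+1 - i))).
  rewrite big_nat_recr //= subnn mulr0 addr0 big_ltn // mul0r add0r mulr_suml.
  apply: eq_big_nat => i /andP[i0 iN]; rewrite (gtn_eqF i0) subn_eq0 leqNgt iN /=.
  by rewrite invfM mulrACA.
rewrite (horner_coef_wide _ sp) mulr_suml; apply: eq_bigr => j _ /=.
have nz k : k`!%:R != 0 :> rat by rewrite pnatr_eq0 -lt0n fact_gt0.
by field; rewrite !nz.
Qed.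

(** * Quasi-shuffle product of truncated brackets *)

Section QuasiShuffle.

(** The new outer index is [u.+1]; taking [f] at [u] keeps the inner indices strictly below it. *)
Definition prepend (a : nat) (f : nat -> fps rat) : nat -> fps rat :=
  fun N => \sum_(u < N) fps_dil u.+1 (Li a) * f u.

(* [trunc_bracket r N] is the part of [r_1 + 1, ..., r_l + 1] with [u_1 <= N];
   words carry the exponents [r_i = s_i - 1], so that every word is allowed. *)
Fixpoint trunc_bracket (r : seq nat) : nat -> fps rat :=
  if r is a :: r' then prepend a (trunc_bracket r') else fun=> 1.

Definition trunc_brackets (k l : nat) : set (nat -> fps rat) :=
  [set trunc_bracket r | r in [set r | (sumn r + size r <= k)%N /\ (size r <= l)%N]].

Lemma lspan_prepend a k l f :
  lspan (trunc_brackets k l) f ->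
  lspan (trunc_brackets (k + a.+1) l.+1) (prepend a f).
Proof.
move: f; apply: lspan_ind => [|c f g If Ig|_ [r [rk rl] <-]].
- rewrite (_ : prepend a 0 = 0); first exact: lspan0.
  by apply/funext => N; rewrite /prepend big1 // => u _; rewrite mulr0.
- rewrite (_ : prepend a _ = c *: prepend a f + prepend a g).
    exact: lspan_linear.
  apply/funext => N; rewrite /prepend /= !fctE scaler_sumr -big_split.
  by apply: eq_bigr => u _; rewrite mulrDr -scalerAr.
by apply: lspan_sub; exists (a :: r) => //; split=> //=; lia.
Qed.

(* Quasi-shuffle: a pair of outer indices [u, u'] has [u > u'], [u < u'] or
   [u = u']. *)
Lemma prepend_mul a b f g :
  exists c : 'I_(a + b).+2 -> rat,
  prepend a f * prepend b g =
    prepend a (f * prepend b g) + prepend b (prepend a f * g) +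
    \sum_j c j *: prepend j (f * g).
Proof.
have [c cP] := Li_mul a b; exists c; apply/funext => N.
rewrite !fctE fct_sumE.
elim: N => [|N IH].
  rewrite /prepend !big_ord0 mul0r !add0r big1 // => j _.
  by rewrite fctE big_ord0 scaler0.
have prependS e h : prepend e h N.+1 =
    prepend e h N + fps_dil N.+1 (Li e) * h N by rewrite /prepend big_ord_recr.
rewrite !prependS mulrDl !mulrDr IH.
under [in RHS]eq_bigr do rewrite fctE prependS scalerDr.
rewrite big_split /=.
(* The case where both outer indices equal [N.+1]. *)
have -> : \sum_j c j *: (fps_dil N.+1 (Li j) * (f * g) N) =
   fps_dil N.+1 (Li a) * fps_dil N.+1 (Li b) * (f N * g N).
  rewrite -fps_dilM // cP fps_dil_sum mulr_suml.
  by apply: eq_bigr => j _; rewrite scalerAl.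
under eq_bigr do rewrite fctE.
ring.
Qed.

(** Nested induction on the two words: each term of [prepend_mul] prepends a letter to a product
    with at least one word shortened. *)
Lemma trunc_bracket_mul r t :
  lspan (trunc_brackets (sumn r + size r + (sumn t + size t)) (size r + size t))
    (trunc_bracket r * trunc_bracket t).
Proof.
elim: r t => [|a r IHr] t.
  by rewrite mul1r; apply: lspan_sub; exists t.
elim: t => [|b t IHt].
  by rewrite mulr1; apply: lspan_sub; exists (a :: r); rewrite ?addn0.
have [c ->] := prepend_mul a b (trunc_bracket r) (trunc_bracket t).
apply: lspanD; first apply: lspanD.
- have := lspan_prepend a (IHr (b :: t)); apply: lspanS => _ [w [wk wl] <-].
  by exists w => //; split; [apply: leq_trans wk _ | apply: leq_trans wl _];
    rewrite /=; lia.
- have := lspan_prepend b IHt; apply: lspanS => _ [w [wk wl] <-].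
  by exists w => //; split; [apply: leq_trans wk _ | apply: leq_trans wl _];
    rewrite /=; lia.
(* Since [j <= a + b + 1], the merged letter has weight [j + 1] at most [(a + 1) + (b + 1)], and the
   length drops by one. *)
apply: lspan_sum => j; apply: lspanZ.
have := lspan_prepend j (IHr t); apply: lspanS => _ [w [wk wl] <-].
have := ltn_ord j.
by exists w => //; split; [apply: leq_trans wk _ | apply: leq_trans wl _];
  rewrite /=; lia.
Qed.

End QuasiShuffle.

(** * Truncated brackets as divisor sums, and the limit in [N] *)

Section DivisorSums.

Section FinfunCons.
Variables (T : finType) (l : nat).

Definition ffun_cons (x : T) (f : {ffun 'I_l -> T}) : {ffun 'I_l.+1 -> T} :=
  [ffun i => oapp f x (unlift ord0 i)].

Lemma ffun_cons0 x f : ffun_cons x f ord0 = x.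
Proof. by rewrite ffunE unlift_none. Qed.

Lemma ffun_consS x f i : ffun_cons x f (lift ord0 i) = f i.
Proof. by rewrite ffunE liftK. Qed.

Lemma sum_ffun_cons (R : nmodType) (F : {ffun 'I_l.+1 -> T} -> R) :
  \sum_f F f = \sum_x \sum_f F (ffun_cons x f).
Proof.
rewrite pair_big (reindex (fun p : T * {ffun 'I_l -> T} => ffun_cons p.1 p.2)) //.
exists (fun f : {ffun 'I_l.+1 -> T} => (f ord0, [ffun i => f (lift ord0 i)]))
  => [[x f]|f] _ /=.
  by rewrite ffun_cons0; congr pair; apply/ffunP => i; rewrite ffunE ffun_consS.
apply/ffunP => i; case: (unliftP ord0 i) => [j|] ->; last by rewrite ffun_cons0.
by rewrite ffun_consS ffunE.
Qed.

End FinfunCons.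

Lemma sum_ffun0 (T : finType) (R : nmodType) (F : {ffun 'I_0 -> T} -> R) f :
  \sum_g F g = F f.
Proof.
rewrite (bigD1 f) //= big1 ?addr0 // => g /eqP[].
by apply/ffunP => -[].
Qed.

Lemma forall_ordS l (P : pred 'I_l.+1) :
  [forall i, P i] = P ord0 && [forall i, P (lift ord0 i)].
Proof.
apply/forallP/andP => [PP|[P0 /forallP PS] i]; first by split=> //; apply/forallP.
by case: (unliftP ord0 i) => [j|] ->.
Qed.

(** The index conditions of [mdsum] with the truncation [u i <= N]. The range [M] is separate from
    [n], so that recursion may lower [n] without changing types. *)
Definition admissible (l M N n : nat) (u v : {ffun 'I_l -> 'I_M.+1}) : bool :=
  [&& [forall i, 0 < u i <= N], [forall i, 0 < v i],
      [forall i : 'I_l, forall j : 'I_l, (i < j) ==> (u j < u i)]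
    & \sum_(i < l) u i * v i == n]%N.

Lemma admissible_cons l M N n x y (u v : {ffun 'I_l -> 'I_M.+1}) :
  admissible N n (ffun_cons x u) (ffun_cons y v) =
  [&& 0 < x <= N, 0 < y, x * y <= n & admissible x.-1 (n - x * y) u v]%N.
Proof.
rewrite /admissible.
have -> : [forall i, 0 < ffun_cons x u i <= N]%N =
    (0 < x <= N)%N && [forall i, 0 < u i <= N]%N.
  by rewrite forall_ordS ffun_cons0; congr andb; apply: eq_forallb => i;
    rewrite ffun_consS.
have -> : [forall i, 0 < ffun_cons y v i]%N = (0 < y)%N && [forall i, 0 < v i]%N.
  by rewrite forall_ordS ffun_cons0; congr andb; apply: eq_forallb => i;
    rewrite ffun_consS.
have -> : [forall i : 'I_l.+1, forall j : 'I_l.+1,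
      (i < j) ==> (ffun_cons x u j < ffun_cons x u i)]%N =
    [forall i, u i < x]%N &&
    [forall i : 'I_l, forall j : 'I_l, (i < j) ==> (u j < u i)]%N.
  rewrite forall_ordS forall_ordS /= ffun_cons0; congr andb.
    by apply: eq_forallb => i; rewrite ffun_consS.
  apply: eq_forallb => i; rewrite forall_ordS /=.
  by apply: eq_forallb => j; rewrite !ffun_consS ltnS.
rewrite big_ord_recl !ffun_cons0.
under eq_bigr do rewrite !ffun_consS.
set S := (\sum_(i < l) _)%N.
have -> : ((x * y + S)%N == n) = (x * y <= n)%N && (S == (n - x * y)%N).
  by lia.
have [x0|x0] := posnP x; first by rewrite x0.
have [xN|xN] := leqP x N; rewrite /= ?andbF //.
(* As [x <= N], the bound [x.-1] encodes both the truncation and the ordering below [x]. *)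
have -> : [forall i, 0 < u i <= x.-1]%N =
    [forall i, 0 < u i <= N]%N && [forall i, u i < x]%N.
  apply/forallP/andP => [P|[/forallP P /forallP Q] i].
    by split; apply/forallP => i; have := P i; lia.
  by have := P i; have := Q i; lia.
rewrite -!andbA; do !bool_congr.
Qed.

Definition weighted_sum (l : nat) (g : nat -> nat -> rat) (M N n : nat) : rat :=
  \sum_(u : {ffun 'I_l -> 'I_M.+1}) \sum_(v | admissible N n u v)
    \prod_(i < l) g i (v i).

(** Splitting off the outermost pair gives the recursion obeyed by the coefficients of [prepend]. *)
Lemma weighted_sumS l g M N n : (N <= M)%N ->
  weighted_sum l.+1 g M N n =
  \sum_(x < N) \sum_(y < M.+1 | ((0 < y) && (x.+1 * y <= n))%N)
     g 0 y * weighted_sum l (g \o succn) M x (n - x.+1 * y).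
Proof.
move=> NM; rewrite /weighted_sum sum_ffun_cons.
transitivity (\sum_(x < M.+1 | (0 < x <= N)%N)
   \sum_(y < M.+1 | ((0 < y) && (x * y <= n))%N)
     g 0 y * weighted_sum l (g \o succn) M x.-1 (n - x * y)).
  rewrite [RHS]big_mkcond; apply: eq_bigr => x _.
  transitivity (\sum_(u : {ffun 'I_l -> 'I_M.+1}) \sum_(y < M.+1)
      if [&& 0 < x <= N, 0 < y & x * y <= n]%N then
        g 0 y * \sum_(v | admissible x.-1 (n - x * y) u v) \prod_(i < l) g i.+1 (v i)
      else 0).
    apply: eq_bigr => u _; rewrite big_mkcond sum_ffun_cons.
    apply: eq_bigr => y _.
    under eq_bigr do rewrite admissible_cons big_ord_recl ffun_cons0.
    rewrite -big_mkcond.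
    case: ifP => c.
      rewrite mulr_sumr; apply: eq_big => [v|v _].
        by move: c => /and3P[-> -> ->].
      by congr (_ * _); apply: eq_bigr => i _; rewrite ffun_consS.
    rewrite big_pred0 // => v; move: c.
    by case: (0 < x <= N)%N; case: (0 < y)%N; case: (x * y <= n)%N.
  rewrite exchange_big /=; case: ifP => xN; last first.
    by rewrite big1 // => y _; rewrite big1.
  rewrite [RHS]big_mkcond; apply: eq_bigr => y _; case: ifP => yP.
    by rewrite mulr_sumr.
  by rewrite big1.
(* The term [x = 0] drops out and [x] is shifted by one. *)
rewrite big_mkcond big_ord_recl /= add0r.
rewrite [RHS](big_ord_widen M (fun x =>
     \sum_(y < M.+1 | ((0 < y) && (x.+1 * y <= n))%N)
     g 0 y * weighted_sum l (g \o succn) M x (n - x.+1 * y))) //.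
by rewrite [RHS]big_mkcond.
Qed.

Lemma trunc_bracket_coef r M N n : (N <= M)%N -> (n <= M)%N ->
  fps_coef (trunc_bracket r N) n =
  weighted_sum (size r) (fun i => fps_coef (Li (nth 0%N r i))) M N n.
Proof.
elim: r N n => [|a r IH] N n NM nM.
  rewrite /weighted_sum (sum_ffun0 _ [ffun=> ord0]) big_mkcond.
  rewrite (sum_ffun0 _ [ffun=> ord0]) !big_ord0 /admissible big_ord0 eq_sym.
  do 3 (rewrite (_ : [forall _, _]); last by apply/forallP; case).
  by rewrite /= eq_sym; case: eqP.
rewrite weighted_sumS // fps_coef_sum; apply: eq_bigr => u _.
rewrite (@fps_coef_dilM _ u.+1 n M) //.
rewrite [LHS]big_mkcond [RHS]big_mkcond; apply: eq_bigr => v _.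
(* The divisor sum omits [v = 0], where [Li] has coefficient zero. *)
have [v0|v0] := posnP v; first by rewrite v0 mul0r; case: ifP.
case: ifP => //= le; rewrite IH //.
  by rewrite (leq_trans _ NM) // ltnW.
by rewrite (leq_trans (leq_subr _ _)).
Qed.

Lemma bracket_coef r n :
  fps_coef (bracket (map succn r)) n = fps_coef (trunc_bracket r n) n.
Proof.
case: r => [//|a r]; rewrite [bracket _]/= fps_coefZ.
set s := a :: r; rewrite -[a.+1 :: _]/(map succn s) big_map -map_comp map_id.
case: n => [|n]; first by rewrite mulr0 /= /prepend big_ord0.
rewrite [fps_coef (Fps _) _]/= (@trunc_bracket_coef s n.+1) //.
rewrite /mdsum /weighted_sum natr_sum mulr_sumr; apply: eq_bigr => u _.
rewrite natr_sum mulr_sumr; apply: eq_big => [v|v].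
  rewrite /admissible; congr [&& _, _, _ & _]; apply: eq_forallb => i.
  (* With [N] equal to the range bound, the truncation is automatic. *)
  by rewrite [X in _ && X]leq_ord andbT.
case/and4P=> _ /forallP v0 _ _.
rewrite natr_prod (big_nth 0%N) big_mkord -prodfV -big_split.
by apply: eq_bigr => i _ /=; rewrite gtn_eqF ?v0 // mulrC natrX.
Qed.

(** On truncated brackets this is the limit in [N], by stationarity of coefficients. *)
Definition diagonal (f : nat -> fps rat) : fps rat := Fps (fun n => fps_coef (f n) n).

Lemma diagonal_linear c f g : diagonal (c *: f + g) = c *: diagonal f + diagonal g.
Proof. by []. Qed.

Lemma bracket_diagonal r : bracket (map succn r) = diagonal (trunc_bracket r).
Proof. by apply: fpsP => n; rewrite bracket_coef. Qed.

(** An outer index [u > n] contributes only powers [q ^ (u v)] with [v >= 1], beyond degree [n]. *)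
Lemma trunc_bracket_stable r n N : (n <= N)%N ->
  fps_coef (trunc_bracket r N) n = fps_coef (trunc_bracket r n) n.
Proof.
case: r => [//|a r] nN; rewrite -(subnKC nN); elim: (N - n)%N => [|d IH].
  by rewrite addn0.
rewrite addnS -[RHS]IH /= /prepend big_ord_recr fps_coefD.
rewrite (@fps_coef_dilM _ (n + d).+1 n n) // -[RHS]addr0; congr (_ + _).
apply: big1 => v le; have [->|v0] := posnP v; first by rewrite mul0r.
by have : ((n + d).+1 <= (n + d).+1 * v)%N by [rewrite leq_pmulr]; lia.
Qed.

(** [diagonal] is not multiplicative in general; here the coefficients at [i] and [n - i] are
    already stationary at truncation [n]. *)
Lemma bracketM r t :
  bracket (map succn r) * bracket (map succn t) =
  diagonal (trunc_bracket r * trunc_bracket t).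
Proof.
apply: fpsP => n; rewrite !bracket_diagonal /= [RHS]fps_coefM.
apply: eq_bigr => i _ /=; have le : (i <= n)%N by rewrite -ltnS.
by rewrite (trunc_bracket_stable _ le) (trunc_bracket_stable _ (leq_subr i n)).
Qed.

End DivisorSums.

(** * Transfer to brackets, the filtration and the algebra *)

Lemma weight_succ r : weight (map succn r) = (sumn r + size r)%N.
Proof. by rewrite /weight; elim: r => //= x r ->; lia. Qed.

Lemma lspan_diagonal k l f :
  lspan (trunc_brackets k l) f -> FilWL k l (diagonal f).
Proof.
move: f; apply: lspan_ind => [|c f g If Ig|_ [r [rk rl] <-]].
- rewrite (_ : diagonal 0 = 0); first exact: lspan0.
  exact: fpsP.
- by rewrite diagonal_linear; exact: lspan_linear.
rewrite -bracket_diagonal; apply: lspan_sub; exists (map succn r) => //.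
split; first by apply/allP => _ /mapP[x _ ->].
  by rewrite weight_succ.
by rewrite size_map.
Qed.

Lemma index_seqE s : index_seq s -> s = map succn (map predn s).
Proof.
move=> /allP s0; rewrite -map_comp -[LHS]map_id; apply/eq_in_map => x /s0 /= x0.
by rewrite prednK.
Qed.

Lemma FilWL_mul k1 l1 k2 l2 f g :
  FilWL k1 l1 f -> FilWL k2 l2 g -> FilWL (k1 + k2) (l1 + l2) (f * g).
Proof.
apply: lspanM => _ _ [s [s0 sk sl] <-] [t [t0 tk tl] <-].
move: sk sl tk tl; rewrite (index_seqE s0) (index_seqE t0).
rewrite !weight_succ ![size (map succn _)]size_map.
set r1 := map _ s; set r2 := map _ t => sk sl tk tl.
rewrite bracketM; have := lspan_diagonal (trunc_bracket_mul r1 r2).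
apply: lspanS => _ [w [w0 wk wl] <-]; exists w => //; split=> //.
  by apply: leq_trans wk _; rewrite leq_add.
by apply: leq_trans wl _; rewrite leq_add.
Qed.

(** Each generator lies in the filtration step given by its own weight and length, and every step is
    contained in [MD]. *)
Lemma MD_mul f g : MD f -> MD g -> MD (f * g).
Proof.
apply: lspanM => _ _ [s s0 <-] [t t0 <-].
have FilMD k l : FilWL k l `<=` MD by apply: lspanS => _ [w [w0 _ _] <-]; exists w.
apply: FilMD; apply: (@FilWL_mul (weight s) (size s) (weight t) (size t)).
  by apply: lspan_sub; exists s.
by apply: lspan_sub; exists t.
Qed.

Theorem mainTheorem1 :
  GRing.subalg_closed (mem MD) /\
  (forall k1 k2 l1 l2 : nat,
     [set f * g | f in FilWL k1 l1 & g in FilWL k2 l2]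
       `<=` FilWL (k1 + k2)%N (l1 + l2)%N).
Proof.
split; last by move=> k1 k2 l1 l2 _ [f Ff [g Gg <-]]; exact: FilWL_mul.
split.
(* The unit is the empty bracket. *)
- by apply/mem_set; apply: lspan_sub; exists [::].
- by move=> a f g /set_mem Mf /set_mem Mg; apply/mem_set; exact: lspan_linear.
by move=> f g /set_mem Mf /set_mem Mg; apply/mem_set; exact: MD_mul.
Qed.
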